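(* Let $F$ be a non-abelian free group of finite rank with a fixed choice of free generators, and let $w, w'$ be reduced words in these generators. Let $\beta_w,\beta_{w'}\in \mathrm{H}_{\mathrm b}^2(F, \mathbf{R})$ be the bounded cohomology classes associated to the Brooks quasimorphisms $f_w$ and $f_{w'}$ on $F$. Then $\beta_w\cup \beta_{w'}=0$ in $\mathrm{H}_{\mathrm b}^4(F,\mathbf{R})$.
   Context: For a reduced word $w$ in the chosen free generators of $F$, the Brooks counting function $f_w\colon F\to\mathbf{R}$ is defined by $$f_w(g)=\sharp\{\text{occurrences of } w \text{ in } g\} - \sharp\{\text{occurrences of } w \text{ in } g^{-1}\},$$ where $g$ and $g^{-1}$ are written as reduced words, an occurrence is an occurrence as a contiguous subword, and overlapping occurrences are all counted. (For $w$ trivial, $f_w$ is taken to be $0$.) The function $f_w$ is a quasimorphism, i.e. $\sup_{g,h}|f_w(g)+f_w(h)-f_w(gh)|<\infty$. $\mathrm{H}_{\mathrm b}^*(F,\mathbf{R})$ denotes bounded cohomology with trivial real coefficients, i.e. the cohomology of the complex of $F$-invariant bounded functions $F^{q+1}\to\mathbf{R}$ with the usual homogeneous (alternating sum) coboundary $d$. The class $\beta_w\in \mathrm{H}_{\mathrm b}^2(F, \mathbf{R})$ is the class of the bounded cocycle obtained as coboundary of $f_w$, i.e. of $(g_0,g_1,g_2)\mapsto f_w(g_1^{-1}g_2)-f_w(g_0^{-1}g_2)+f_w(g_0^{-1}g_1)$. The symbol $\cup$ is the cup product, given on homogeneous cocycles by $(\alpha\cup\beta)(g_0,\dots,g_4)=\alpha(g_0,g_1,g_2)\,\beta(g_2,g_3,g_4)$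 in degrees $(2,2)$. *)

(* Defs.v *)
From HB Require Import structures.
From mathcomp Require Import all_boot all_order all_algebra.
From mathcomp Require Import boolp functions reals.
From mathcomp Require Import zify ring lra.

Set Implicit Arguments.
Unset Strict Implicit.
Unset Printing Implicit Defensive.

Import Order.TTheory GRing.Theory Num.Theory.

(* The free group of rank n, realised by reduced words: the letter (i, false) *)
(* is the i-th free generator, and (i, true) is its inverse.                  *)

Section FreeGroup.
Variable n : nat.

Local Notation letter := ('I_n * bool)%type.

Definition linv (x : letter) : letter := (x.1, ~~ x.2).

Lemma linvK : involutive linv.
Proof. by case=> i b; rewrite /linv /= negbK. Qed.

Definition reduced (s : seq letter) : bool := sorted (fun x y => y != linv x) s.

Definition winv (s : seq letter) : seq letter := rev (map linv s).

Lemma winvK : involutive winv.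
Proof.
move=> s; rewrite /winv map_rev revK -map_comp -[RHS]map_id.
by apply: eq_map => x /=; rewrite linvK.
Qed.

Lemma winv_cat s t : winv (s ++ t) = winv t ++ winv s.
Proof. by rewrite /winv map_cat rev_cat. Qed.

Definition lstep (x : letter) (s : seq letter) : seq letter :=
  if s is y :: s' then if y == linv x then s' else x :: s else [:: x].

(* Concatenation followed by reduction, for reduced arguments. *)
Definition wmul (s t : seq letter) : seq letter := foldr lstep t s.

Lemma lstep_reduced x s : reduced s -> reduced (lstep x s).
Proof.
case: s => [|y s] //= rs; case: eqP => [_|/eqP nyx]; first exact: path_sorted rs.
by rewrite /reduced /= nyx.
Qed.

Lemma wmul_reduced s t : reduced t -> reduced (wmul s t).
Proof. by move=> rt; elim: s => //= x s; apply: lstep_reduced. Qed.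

Lemma winv_reduced s : reduced s -> reduced (winv s).
Proof.
rewrite /reduced /winv rev_sorted sorted_map; apply: sub_sorted => x y /=.
by rewrite -(can_eq linvK) !linvK eq_sym -(can_eq linvK) linvK.
Qed.

Lemma lstepK x s : reduced s -> lstep x (lstep (linv x) s) = s.
Proof.
case: s => [|y s] /=; first by rewrite eqxx.
rewrite linvK; case: eqP => [-> |_] /=; last by rewrite eqxx.
by case: s => [|z s] //= /andP[/negPf-> _].
Qed.

Lemma wmul_lstep x s t : reduced s -> reduced t ->
  wmul (lstep x s) t = lstep x (wmul s t).
Proof.
case: s => [|y s] //= rs rt; case: eqP => [-> |_] //=.
by rewrite lstepK ?wmul_reduced.
Qed.

Lemma wmulA s t u : reduced s -> reduced t -> reduced u ->
  wmul s (wmul t u) = wmul (wmul s t) u.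
Proof.
move=> rs rt ru; elim: s rs => //= x s IH rs.
by rewrite IH ?wmul_lstep ?wmul_reduced //; apply: path_sorted rs.
Qed.

Lemma wmuls0 s : reduced s -> wmul s [::] = s.
Proof.
elim: s => //= x s IH rs; rewrite (IH (path_sorted rs)).
by case: s rs {IH} => //= y s /andP[/negPf-> _].
Qed.

(* The shape of a product: only a common middle part cancels. *)
Lemma wmulP s t : reduced s -> exists a c b,
  [/\ s = a ++ c, t = winv c ++ b & wmul s t = a ++ b].
Proof.
elim: s => [|x s IH] rs; first by exists [::], [::], t.
have [a [c [b [es et em]]]] := IH (path_sorted rs).
case: a es em => [|y a] es em; last first.
  exists (x :: y :: a), c, b; split=> //; first by rewrite es.
  by rewrite /= em /=; move: rs; rewrite es /reduced /= => /andP[/negPf-> _].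
case: b em et => [|y b] em et.
  by exists [:: x], c, [::]; split=> //; rewrite /= ?em ?es.
have [eyx|nyx] := eqVneq y (linv x).
  exists [::], (x :: c), b; split; first by rewrite es.
    by rewrite et eyx /winv /= rev_cons -cats1 -catA.
  by rewrite /= em /= eyx eqxx.
exists [:: x], c, (y :: b); split=> //; first by rewrite es.
by rewrite /= em /= (negPf nyx).
Qed.

Lemma wmulV s : reduced s -> wmul (winv s) s = [::].
Proof.
elim: s => [|x s IH] rs //.
rewrite /winv /= rev_cons /wmul -cats1 foldr_cat /= linvK eqxx.
exact: IH (path_sorted rs).
Qed.

Definition free_group : Type := {s : seq letter | reduced s}.
HB.instance Definition _ := SubType.on free_group.
HB.instance Definition _ := Choice.on free_group.

Definition fg_one : free_group := Sub [::] isT.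
Definition fg_mul (g h : free_group) : free_group :=
  Sub (wmul (val g) (val h)) (wmul_reduced (val g) (valP h)).
Definition fg_inv (g : free_group) : free_group :=
  Sub (winv (val g)) (winv_reduced (valP g)).

Fact fg_mulA : associative fg_mul.
Proof. by move=> g h k; apply: val_inj; apply: wmulA; apply: valP. Qed.
Fact fg_mul1 : left_id fg_one fg_mul.
Proof. by move=> g; apply: val_inj. Qed.
Fact fg_mulr1 : right_id fg_one fg_mul.
Proof. by move=> g; apply: val_inj; apply: wmuls0; apply: valP. Qed.
Fact fg_mulV : left_inverse fg_one fg_inv fg_mul.
Proof. by move=> g; apply: val_inj; apply: wmulV; apply: valP. Qed.
Fact fg_mulrV : right_inverse fg_one fg_inv fg_mul.
Proof.
move=> g; have := fg_mulV (fg_inv g); congr (fg_mul _ _ = _).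
by apply: val_inj; apply: winvK.
Qed.

HB.instance Definition _ := isGroup.Build free_group
  fg_mulA fg_mul1 fg_mulr1 fg_mulV fg_mulrV.

End FreeGroup.

Local Open Scope ring_scope.

Section BoundedCohomology.
Variables (R : realType) (G : groupType).

(* Homogeneous q-cochains, i.e. functions of g_0, ..., g_q. *)
Definition cochain (q : nat) : Type := ('I_q.+1 -> G) -> R.
HB.instance Definition _ q := GRing.Zmodule.on (cochain q).

Definition diag_invariant q (c : cochain q) : Prop :=
  forall (h : G) (g : 'I_q.+1 -> G), c (fun i => h * g i)%g = c g.

Definition bounded_cochain q (c : cochain q) : Prop :=
  exists M : R, forall g, `|c g| <= M.

Definition coboundary q (c : cochain q) : cochain q.+1 :=
  fun g => \sum_(i < q.+2) (-1) ^+ i * c (g \o lift i).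

Definition bcochain q (c : cochain q) : Prop :=
  bounded_cochain c /\ diag_invariant c.

Definition is_bcocycle q : cochain q -> bool :=
  fun c => `[< bcochain c /\ coboundary c = 0 >].

Lemma bcochainB q (c c' : cochain q) :
  bcochain c -> bcochain c' -> bcochain (c - c').
Proof.
move=> [[M cM] ci] [[M' cM'] ci']; split.
  exists (M + M') => g; apply: le_trans (ler_normB _ _) _.
  exact: lerD (cM g) (cM' g).
by move=> h g; rewrite /GRing.add /GRing.opp /= ci ci'.
Qed.

Lemma bcochain0 q : bcochain (0 : cochain q).
Proof. by split=> //; exists 0 => g; rewrite normr0. Qed.

Lemma coboundaryB q (c c' : cochain q) :
  coboundary (c - c') = coboundary c - coboundary c'.
Proof.
apply: funext => g.
rewrite /coboundary -[RHS]sumrB; apply: eq_bigr => i _.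
exact: mulrBr.
Qed.

Lemma coboundary0 q : coboundary (0 : cochain q) = 0.
Proof. by rewrite -(subrr 0) coboundaryB subrr. Qed.

Fact is_bcocycle_zmod q : zmod_closed (@is_bcocycle q).
Proof.
split=> [|c c' /asboolP[bc dc] /asboolP[bc' dc']]; apply/asboolP.
  by split; [exact: bcochain0 | exact: coboundary0].
by split; [exact: bcochainB | rewrite coboundaryB dc dc' subrr].
Qed.
HB.instance Definition _ q :=
  GRing.isZmodClosed.Build (cochain q) (@is_bcocycle q) (is_bcocycle_zmod q).

Definition bcocycle q : Type := {c : cochain q | is_bcocycle c}.
HB.instance Definition _ q := SubChoice.on (bcocycle q).
HB.instance Definition _ q := [SubChoice_isSubZmodule of bcocycle q by <:].

(* The bounded complex starts in degree 0, so there are no nonzero            *)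
(* coboundaries there.                                                        *)
Definition is_bcoboundary_of q : cochain q -> Prop :=
  match q with
  | 0 => fun c => c = 0
  | q'.+1 => fun c => exists2 b : cochain q', bcochain b & c = coboundary b
  end.

Definition is_bcoboundary q : bcocycle q -> bool :=
  fun z => `[< is_bcoboundary_of (val z) >].

Lemma is_bcoboundary_ofB q (c c' : cochain q) :
  is_bcoboundary_of c -> is_bcoboundary_of c' -> is_bcoboundary_of (c - c').
Proof.
case: q c c' => [|q] c c' /=; first by move=> -> ->; rewrite subrr.
move=> [b bb ->] [b' bb' ->]; exists (b - b'); first exact: bcochainB.
by rewrite coboundaryB.
Qed.

Lemma is_bcoboundary_of0 q : is_bcoboundary_of (0 : cochain q).
Proof.
by case: q => //= q; exists 0; [exact: bcochain0 | rewrite coboundary0].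
Qed.

Fact is_bcoboundary_zmod q : zmod_closed (@is_bcoboundary q).
Proof.
split=> [|c c' /asboolP bc /asboolP bc']; apply/asboolP.
  by rewrite raddf0; exact: is_bcoboundary_of0.
by rewrite raddfB; exact: is_bcoboundary_ofB.
Qed.
HB.instance Definition _ q :=
  GRing.isZmodClosed.Build (bcocycle q) (@is_bcoboundary q)
    (is_bcoboundary_zmod q).

Definition Hb (q : nat) : Type :=
  @Quotient.quot (bcocycle q) (GRing.ZmodClosed.clone _ (@is_bcoboundary q) _).
HB.instance Definition _ q := GRing.Zmodule.on (Hb q).

Definition Hb_class q (z : bcocycle q) : Hb q := \pi_(Hb q)%qT z.

Lemma alternating_sum_eq0 n (F : nat -> nat -> R) :
  (forall i j, (j <= i)%N -> F i.+1 j = - F j i) ->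
  \sum_(i < n.+1) \sum_(j < n) F i j = 0.
Proof.
move=> FN.
rewrite (eq_bigr (fun i : 'I_n.+1 => \sum_(j < n | (j < i)%N) F i j +
  \sum_(j < n | ~~ (j < i)%N) F i j)); last by move=> i _; exact: bigID.
rewrite big_split /= big_ord_recl /= big_pred0_eq add0r.
rewrite [X in _ + X]big_ord_recr /= [X in _ + (_ + X)]big_pred0; last first.
  by move=> j; rewrite ltn_ord.
rewrite addr0 [X in _ + X](exchange_big_dep predT) //= -big_split big1 //= => i _.
rewrite -[RHS](addNr (\sum_(j < n | (j <= i)%N) F j i)) -sumrN; congr (_ + _).
  by apply: eq_big => // j ji; rewrite /bump add1n FN.
by apply: eq_bigl => j; rewrite -leqNgt.
Qed.

(* Cochains evaluated on sequences of group elements indexed by nat. *)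
Definition ncochain q (c : cochain q) (g : nat -> G) : R := c (fun i => g i).

Lemma coboundaryE q (c : cochain q) (g : nat -> G) :
  ncochain (coboundary c) g =
  \sum_(i < q.+2) (-1) ^+ i * ncochain c (fun k => g (bump i k)).
Proof. by []. Qed.

Lemma ncochain_inord q (c : cochain q) (g : 'I_q.+1 -> G) :
  c g = ncochain c (fun k => g (inord k)).
Proof. by congr c; apply: funext => i; rewrite inord_val. Qed.

Lemma eq_ncochain q (c : cochain q) (g g' : nat -> G) :
  (forall k, (k <= q)%N -> g k = g' k) -> ncochain c g = ncochain c g'.
Proof.
by move=> gg'; congr c; apply: funext => i; rewrite gg' // -ltnS ltn_ord.
Qed.

Lemma coboundaryK q (c : cochain q) : coboundary (coboundary c) = 0.
Proof.
suff dd g : ncochain (coboundary (coboundary c)) g = 0.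
  by apply: funext => g; rewrite ncochain_inord dd.
rewrite coboundaryE.
pose F i j : R := (-1) ^+ i * ((-1) ^+ j *
  ncochain c (fun k => g (bump i (bump j k)))).
rewrite (eq_bigr (fun i : 'I_q.+3 => \sum_(j < q.+2) F i j)).
  apply: alternating_sum_eq0 => i j ji; rewrite /F exprS.
  rewrite (_ : (fun k => g (bump j (bump i k))) =
               (fun k => g (bump i.+1 (bump j k)))); first by ring.
  apply: funext => k; congr g; rewrite /bump; lia.
by move=> i _; rewrite coboundaryE mulr_sumr.
Qed.

(* a is evaluated at (g_0, ..., g_p) and b at (g_p, ..., g_{p+q}).           *)
(* The target degree n is kept separate to avoid casts between p + q.+1 and   *)
(* (p + q).+1; only n = p + q is meaningful.                                  *)
Definition cup_at p q n (a : cochain p) (b : cochain q) : cochain n :=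
  fun g => a (fun i => g (inord i)) * b (fun i => g (inord (p + i)%N)).

Arguments cup_at {p q} n a b g.

Definition cup p q (a : cochain p) (b : cochain q) : cochain (p + q)%N :=
  cup_at (p + q)%N a b.

Lemma cup_atE p q n (a : cochain p) (b : cochain q) (g : nat -> G) :
  n = (p + q)%N ->
  ncochain (cup_at n a b) g = ncochain a g * ncochain b (fun k => g (p + k)%N).
Proof.
move=> en; rewrite /cup_at /ncochain; congr (a _ * b _); apply: funext => i;
  by rewrite inordK //; have := ltn_ord i; lia.
Qed.

Lemma cup_leibniz p q n (a : cochain p) (b : cochain q) (g : nat -> G) :
  n = (p + q)%N ->
  ncochain (coboundary (cup_at n a b)) g =
  ncochain (cup_at n.+1 (coboundary a) b) g +
  (-1) ^+ p * ncochain (cup_at n.+1 a (coboundary b)) g.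
Proof.
move=> en; rewrite !cup_atE ?en ?addnS ?addSn // -en.
pose A i := ncochain a (fun k => g (bump i k)).
pose B i := ncochain b (fun k => g (bump i (p + k)%N)).
pose C i := (-1) ^+ i * (A i * B i).
have -> : ncochain (coboundary (cup_at n a b)) g = \sum_(0 <= i < n.+2) C i.
  by rewrite big_mkord coboundaryE; apply: eq_bigr => i _; rewrite cup_atE.
have -> : n.+2 = (q.+1 + p.+1)%N by lia.
rewrite (@big_cat_nat _ _ _ p.+1) /=; [|lia|lia].
have -> : \sum_(p.+1 <= i < q.+1 + p.+1) C i = \sum_(0 <= i < q.+1) C (i + p.+1)%N.
  by rewrite -{1}[p.+1]add0n big_addn addnK.
rewrite !big_mkord !coboundaryE.
rewrite [\sum_(i < p.+2) _]big_ord_recr [\sum_(i < q.+2) _]big_ord_recl /=.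
rewrite mulrDl !mulrDr -!addrA; congr (_ + _).
  rewrite mulr_suml; apply: eq_bigr => i _; rewrite /C mulrA.
  congr (_ * _); apply: eq_ncochain => k _; congr g.
  by have := ltn_ord i; rewrite /bump; lia.
rewrite expr0 mul1r addrA [X in _ = X + _](_ : _ = 0) ?add0r; last first.
  rewrite (@eq_ncochain _ a (fun k => g (bump p.+1 k)) g); last first.
    by move=> k kp; congr g; rewrite /bump; lia.
  rewrite (@eq_ncochain _ b (fun k => g (p + bump 0 k)%N)
    (fun k => g (p.+1 + k)%N)); last first.
    by move=> k kp; congr g; rewrite /bump; lia.
  by rewrite exprS; ring.
rewrite !mulr_sumr; apply: eq_bigr => i _; rewrite /C /A /B.
rewrite (@eq_ncochain _ a (fun k => g (bump (i + p.+1) k)) g); last first.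
  by move=> k kp; congr g; rewrite /bump; lia.
rewrite (@eq_ncochain _ b (fun k => g (bump (i + p.+1) (p + k)%N))
  (fun k => g (p + bump (bump 0 i) k)%N)); last first.
  by move=> k kp; congr g; rewrite /bump; lia.
by rewrite [bump 0 i]/bump leq0n add1n addnS -addSn exprD; ring.
Qed.

Lemma bcochain_cup_at p q n (a : cochain p) (b : cochain q) :
  bcochain a -> bcochain b -> bcochain (cup_at n a b).
Proof.
move=> [[M aM] ai] [[M' bM'] bi]; split.
  by exists (M * M') => g; rewrite normrM ler_pM.
by move=> h g; rewrite /cup_at ai bi.
Qed.

Lemma cup_at_cocycle p q n (a : bcocycle p) (b : bcocycle q) :
  n = (p + q)%N -> is_bcocycle (cup_at n (val a) (val b)).
Proof.
case: a b => a /= /asboolP[ba da] [b /= /asboolP[bb db]] en.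
apply/asboolP; split; first exact: bcochain_cup_at.
apply: funext => g; rewrite ncochain_inord cup_leibniz // da db.
by rewrite !cup_atE ?en ?addnS ?addSn // mulr0 mul0r mulr0 addr0.
Qed.

Definition bcocycle_cup p q (a : bcocycle p) (b : bcocycle q) :
  bcocycle (p + q)%N := Sub (cup (val a) (val b)) (cup_at_cocycle a b erefl).

(* Independent of the chosen representatives, by Hb_cupE below. *)
Definition Hb_cup p q (x : Hb p) (y : Hb q) : Hb (p + q)%N :=
  Hb_class (bcocycle_cup (repr x) (repr y)).

Lemma ncochainP q (c c' : cochain q) :
  (forall g, ncochain c g = ncochain c' g) -> c = c'.
Proof.
by move=> cc'; apply: funext => g; rewrite !ncochain_inord cc'.
Qed.

Lemma bcoboundary_cupl p q n (a : cochain p) (b : bcocycle q) :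
  n = (p + q)%N -> is_bcoboundary_of a -> is_bcoboundary_of (cup_at n a (val b)).
Proof.
case: b => b /= /asboolP[bb db].
case: p a => [|p] a en /=.
  move=> ->; rewrite (_ : cup_at _ _ _ = 0); first exact: is_bcoboundary_of0.
  by apply: funext => g; rewrite /cup_at mul0r.
rewrite addSn in en; rewrite {n}en => -[c bc ->] /=.
exists (cup_at (p + q)%N c b); first exact: bcochain_cup_at.
apply: ncochainP => g; rewrite cup_leibniz // db [X in _ * X]cup_atE ?addnS //.
by rewrite [ncochain 0 _](_ : _ = 0) // !mulr0 addr0.
Qed.

Lemma bcoboundary_cupr p q n (a : bcocycle p) (b : cochain q) :
  n = (p + q)%N -> is_bcoboundary_of b -> is_bcoboundary_of (cup_at n (val a) b).
Proof.
case: a => a /= /asboolP[ba da].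
case: q b => [|q] b en /=.
  move=> ->; rewrite (_ : cup_at _ _ _ = 0); first exact: is_bcoboundary_of0.
  by apply: funext => g; rewrite /cup_at mulr0.
rewrite addnS in en; rewrite {n}en => -[c bc ->] /=.
exists (fun g => (-1) ^+ p * cup_at (p + q)%N a c g).
  have [[M cM] ci] := bcochain_cup_at (p + q)%N ba bc; split.
    by exists M => g; rewrite normrMsign; apply: cM.
  by move=> h g; congr (_ * _); apply: ci.
apply: ncochainP => g; transitivity
  ((-1) ^+ p * ncochain (coboundary (cup_at (p + q)%N a c)) g).
  rewrite cup_leibniz // da [X in _ * (X + _)]cup_atE ?addSn //.
  by rewrite [ncochain 0 _](_ : _ = 0) // mul0r add0r signrMK.
rewrite !coboundaryE mulr_sumr; apply: eq_bigr => i _.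
exact: mulrCA.
Qed.

Lemma Hb_classP q (z z' : bcocycle q) :
  (Hb_class z = Hb_class z') <-> is_bcoboundary_of (val z - val z').
Proof.
rewrite -raddfB; split=> [/eqP|zz'].
  by rewrite -Quotient.idealrBE => /asboolP.
by apply/eqP; rewrite -Quotient.idealrBE; apply/asboolP.
Qed.

Lemma Hb_cupE p q (a : bcocycle p) (b : bcocycle q) :
  Hb_cup (Hb_class a) (Hb_class b) = Hb_class (bcocycle_cup a b).
Proof.
rewrite /Hb_cup; set a' := repr _; set b' := repr _.
have ea : Hb_class a' = Hb_class a by rewrite /Hb_class reprK.
have eb : Hb_class b' = Hb_class b by rewrite /Hb_class reprK.
transitivity (Hb_class (bcocycle_cup a b')); apply/Hb_classP => /=.
  rewrite (_ : _ - _ = cup_at (p + q)%N (val a' - val a) (val b')).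
    by apply: bcoboundary_cupl => //; apply/Hb_classP.
  by apply: funext => g; rewrite /cup_at mulrBl.
rewrite (_ : _ - _ = cup_at (p + q)%N (val a) (val b' - val b)).
  by apply: bcoboundary_cupr => //; apply/Hb_classP.
by apply: funext => g; rewrite /cup_at mulrBr.
Qed.

Lemma Hb_class_eq0 q (z : bcocycle q) :
  (Hb_class z = 0) <-> is_bcoboundary_of (val z).
Proof.
have -> : 0 = Hb_class (0 : bcocycle q) by rewrite /Hb_class raddf0.
by rewrite Hb_classP -raddfB subr0.
Qed.

Definition quasimorphism (f : G -> R) : Prop :=
  exists M : R, forall g h, `|f g + f h - f (g * h)%g| <= M.

Definition homogenize (f : G -> R) : cochain 1 :=
  fun g => f ((g ord0)^-1 * g ord_max)%g.

Lemma coboundary_homogenizeE (f : G -> R) (g : nat -> G) :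
  ncochain (coboundary (homogenize f)) g =
  f ((g 1%N)^-1 * g 2%N)%g - f ((g 0%N)^-1 * g 2%N)%g
    + f ((g 0%N)^-1 * g 1%N)%g.
Proof.
rewrite coboundaryE !big_ord_recl big_ord0 /ncochain /homogenize /=.
by rewrite /bump /=; ring.
Qed.

Lemma coboundary_homogenize_bcocycle (f : G -> R) :
  quasimorphism f -> is_bcocycle (coboundary (homogenize f)).
Proof.
move=> [M fM]; apply/asboolP; split; last exact: coboundaryK.
split=> [|h g].
  exists M => g; rewrite ncochain_inord coboundary_homogenizeE.
  move: (g _) (g _) (g _) => x z y.
  have := fM (x^-1 * y)%g (y^-1 * z)%g.
  by rewrite -mulgA mulVKg [f (x^-1 * y)%g + _]addrC addrAC.
apply: eq_bigr => i _; congr (_ * f _) => /=.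
by rewrite invgM -mulgA mulKg.
Qed.

Definition quasimorphism_class (f : G -> R) (qf : quasimorphism f) : Hb 2 :=
  Hb_class (Sub (coboundary (homogenize f)) (coboundary_homogenize_bcocycle qf)).

End BoundedCohomology.

Section Brooks.
Variables (R : realType) (n : nat).
Implicit Types (s t w : seq ('I_n * bool)).

(* The number of positions of s at which w starts; intended for w nonempty. *)
Definition occurrences w s : nat :=
  count (fun i => prefix w (drop i s)) (iota 0 (size s)).

Definition brooks (w g : free_group n) : R :=
  if w == 1%g then 0
  else (occurrences (val w) (val g))%:R - (occurrences (val w) (val g^-1%g))%:R.

Lemma occurrences_cons w x s :
  occurrences w (x :: s) = (prefix w (x :: s) + occurrences w s)%N.
Proof.
rewrite /occurrences /= -[1%N]/(1 + 0)%N iotaDl count_map.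
by congr (_ + _)%N; apply: eq_count.
Qed.

Lemma occurrences_cat w s t : w != [::] ->
  (occurrences w s + occurrences w t <= occurrences w (s ++ t)
   <= occurrences w s + occurrences w t + minn (size s) (size w))%N.
Proof.
move=> w0; elim: s => [|x s IH] /=; first by rewrite min0n addn0 leqnn.
rewrite !occurrences_cons.
have le : (prefix w (x :: s) <= prefix w (x :: s ++ t))%N.
  by case: prefixP => // -[u xs]; rewrite -cat_cons xs -catA prefix_prefix.
have ge : (prefix w (x :: s ++ t) <= prefix w (x :: s) + (size s < size w))%N.
  have [_|ws] := ltnP (size s) (size w); first by case: prefix => /=; lia.
  by rewrite !prefixE -cat_cons take_cat /= ltnS ws addn0.
move: (prefix _ _ : nat) (prefix _ _ : nat) le ge IH => a b; lia.
Qed.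

Lemma brooks_quasimorphism (w : free_group n) : quasimorphism (brooks w).
Proof.
exists (6 * size (val w))%:R => g h; rewrite /brooks.
have [_|w1] := eqVneq w 1%g; first by rewrite subr0 addr0 normr0 ler0n.
have w0 : val w != [::] by rewrite -(inj_eq val_inj) in w1.
have [a [c [b [eg eh em]]]] := wmulP (val h) (valP g).
rewrite (_ : val (g * h)%g = a ++ b) //.
rewrite (_ : val g^-1%g = winv c ++ winv a); last first.
  by rewrite -winv_cat -eg.
rewrite (_ : val h^-1%g = winv b ++ c); last first.
  by rewrite -[X in _ ++ X]winvK -winv_cat -eh.
rewrite (_ : val (g * h)^-1%g = winv b ++ winv a); last first.
  by rewrite -winv_cat -em.
rewrite eg eh.
have err x y : exists2 k : R, 0 <= k <= (size (val w))%:R &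
    (occurrences (val w) (x ++ y))%:R =
    (occurrences (val w) x)%:R + (occurrences (val w) y)%:R + k.
  have /andP[le ge] := occurrences_cat x y w0.
  have ge' := leq_trans ge (leq_add (leqnn _) (geq_minr _ _)).
  exists ((occurrences (val w) (x ++ y))%:R -
    (occurrences (val w) x)%:R - (occurrences (val w) y)%:R); last by ring.
  by move: le ge'; rewrite -!(ler_nat R) !natrD; lra.
have [k1 k1b ->] := err a c; have [k2 k2b ->] := err (winv c) (winv a).
have [k3 k3b ->] := err (winv c) b; have [k4 k4b ->] := err (winv b) c.
have [k5 k5b ->] := err a b; have [k6 k6b ->] := err (winv b) (winv a).
by rewrite natrM ler_norml; lra.
Qed.

Definition brooks_class (w : free_group n) : Hb R (free_group n) 2 :=
  quasimorphism_class (brooks_quasimorphism w).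

End Brooks.

(* Main.v *)
Require Import Defs.
From mathcomp Require Import all_boot all_order all_algebra.
From mathcomp Require Import reals.
From mathcomp Require Import zify ring lra.

Set Implicit Arguments.
Unset Strict Implicit.
Unset Printing Implicit Defensive.

Import Order.TTheory GRing.Theory Num.Theory.

(** The Cayley tree of the free group reduces the problem to four points.
Write phi(x,y) = f (x^-1 y) and psi(x,y) = f' (x^-1 y), so that the classes are
those of d(phi) and of beta = d(psi).  At the level of unbounded cochains
d(phi) \cup beta = d(phi \cup beta), and phi \cup beta may be corrected by
the coboundary of any invariant 2-cochain.  The correction is
  eta(a,b,c) = - phi(a, m(a,b,c)) beta(a,b,c),
with m(a,b,c) the median of a, b, c in the tree (leg_cochain).  The claim is
that phi \cup beta - d(eta) is bounded (bounded_cup_primitive); being also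
invariant, it exhibits the cup product as the coboundary of a bounded cochain.

To see the claim, let m_i and beta_i be the median and the value of beta on the
face of (a,b,c,d) opposite to the i-th vertex.  Since f is a quasimorphism and
beta is bounded, phi \cup beta - d(eta) is, up to a bounded error, the
alternating sum of phi(a,m_i) beta_i.  Four points of a tree form two
tripods joined by a segment [p,q] (four_points), so two of the medians are p and
two are q; as beta is a cocycle, the alternating sum collapses to
  +- (phi(a,p) - phi(a,q)) * (psi(x,z) - psi(x,t) - psi(y,z) + psi(y,t)),
where x, y lie on the side of p and z, t on the side of q.  If [p,q] is short
the first factor is bounded because f is a quasimorphism.  If [p,q] is at least
as long as the counted word, the second factor vanishes: an occurrence of that
word cannot overlap both the part of a geodesic before p and the part after q,
so each of the four values splits at [p,q] and everything cancels
(cross_bridge).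

The argument applies to every quasimorphism f and every odd quasimorphism f'
that splits along long overlaps (cup_quasimorphism_local); Brooks quasimorphisms
are of the second kind. *)

(** * Common prefixes of words *)

Section Words.
Variable T : eqType.
Implicit Types s t u : seq T.

Definition diverge s t : bool :=
  match s, t with x :: _, y :: _ => x != y | _, _ => true end.

Lemma divergeC s t : diverge s t = diverge t s.
Proof. by case: s t => [|x s] [|y t] //=; rewrite eq_sym. Qed.

Lemma diverge_same_head s t r : ~~ diverge s r -> diverge s t -> diverge t r.
Proof.
case: s t r => [|x s] [|y t] [|k r] //=; rewrite negbK => /eqP->.
by rewrite eq_sym.
Qed.

Fixpoint lcp s t : seq T :=
  match s, t with
  | x :: s', y :: t' => if x == y then x :: lcp s' t' else [::]
  | _, _ => [::]
  end.

Lemma lcpP s t : exists s' t',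
  [/\ s = lcp s t ++ s', t = lcp s t ++ t' & diverge s' t'].
Proof.
elim: s t => [|x s IH] [|y t] /=; try by do 2 eexists; split.
case: eqVneq => [<-|xy]; last by exists (x :: s), (y :: t).
have [s' [t' [es et d]]] := IH t.
by exists s', t'; split=> //=; congr (_ :: _).
Qed.

Lemma lcp_cat u s t : diverge s t -> lcp (u ++ s) (u ++ t) = u.
Proof.
move=> d; elim: u => [|x u IH] /=; last by rewrite eqxx IH.
by case: s t d => [|x s] [|y t] //= /negPf->.
Qed.

End Words.

(** * Products without cancellation *)

Section ReducedWords.
Variable n : nat.
Implicit Types (s t : seq ('I_n * bool)) (g h x y z p q : free_group n).

Lemma reduced_winv s : reduced (winv s) = reduced s.
Proof.
by apply/idP/idP => [/winv_reduced|]; [rewrite winvK | exact: winv_reduced].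
Qed.

(** Two words leave a common origin in different directions exactly when going
back along one and out along the other is a reduced path. *)
Lemma reduced_winv_cat s t :
  reduced (winv s ++ t) = [&& reduced s, reduced t & diverge s t].
Proof.
rewrite -[reduced s]reduced_winv; case: s => [|x s] /=; first by rewrite andbT.
case: t => [|y t] /=; first by rewrite cats0 andbT.
rewrite /winv /= rev_cons cat_rcons /reduced.
case: (rev (map _ s)) => [|z r] /=; last rewrite cat_path rcons_path /=.
  by rewrite linvK eq_sym andbC.
rewrite linvK [y == _]eq_sym.
by case: path => //=; case: (_ != _) => //=; rewrite andbC.
Qed.

Lemma reduced_cat s t :
  reduced (s ++ t) = [&& reduced s, reduced t & diverge (winv s) t].
Proof. by rewrite -{1}[s]winvK reduced_winv_cat reduced_winv. Qed.

Lemma wmul_cat s t : reduced (s ++ t) -> wmul s t = s ++ t.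
Proof.
elim: s => //= x s IH r; rewrite IH; last exact: path_sorted r.
by case: (s ++ t) r => //= y l /andP[/negPf->].
Qed.

Lemma val_mul g h :
  (val (g * h)%g == val g ++ val h) = diverge (val g^-1%g) (val h).
Proof.
have -> : diverge (val g^-1%g) (val h) = reduced (val g ++ val h).
  by rewrite reduced_cat (valP g) (valP h).
apply/eqP/idP => [<-|]; [exact: valP | exact: wmul_cat].
Qed.

Lemma val_divl g h s : val g = val h ++ s -> val (h^-1 * g)%g = s.
Proof.
move=> e; have rs : reduced s.
  by have: reduced (val g) := valP g; rewrite e reduced_cat => /and3P[].
suff -> : g = (h * (Sub s rs : free_group n))%g by rewrite mulKg.
by apply: val_inj => /=; rewrite wmul_cat -e //; apply: valP.
Qed.

Definition meet g h : free_group n := insubd (fg_one n) (lcp (val g) (val h)).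

Lemma val_meet g h : val (meet g h) = lcp (val g) (val h).
Proof.
rewrite insubdK //; have [s [t [e _ _]]] := lcpP (val g) (val h).
by have: reduced (val g) := valP g; rewrite {1}e reduced_cat => /and3P[].
Qed.

End ReducedWords.

(** * Medians in the Cayley tree *)

Section Tree.
Variable n : nat.
Implicit Types (a b c d p q x y z t : free_group n).

(** Seen from [p], the points [x] and [y] lie in different directions, or one of
them is [p] itself: this says that [p] is on the geodesic from [x] to [y], in a
form that is visibly symmetric and invariant under left translation. *)
Definition btw p x y : bool := diverge (val (p^-1 * x)%g) (val (p^-1 * y)%g).

Lemma btwC p x y : btw p x y = btw p y x.
Proof. exact: divergeC. Qed.

Lemma btwP p x y :
  reflect (val (x^-1 * y)%g = val (x^-1 * p)%g ++ val (p^-1 * y)%g) (btw p x y).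
Proof.
apply: (iffP idP); rewrite /btw.
  by rewrite -[(p^-1 * x)%g]invgK -val_mul invgM invgK -mulgA mulVKg => /eqP.
by rewrite -[(p^-1 * x)%g]invgK -val_mul invgM invgK -mulgA mulVKg => ->.
Qed.

Lemma btw_trans p q x y : btw p x y -> btw q p y -> btw q x y.
Proof.
move=> /btwP pxy /btwP qpy; apply/btwP.
have: reduced (val (x^-1 * p)%g ++ val (p^-1 * q)%g).
  have: reduced (val (x^-1 * y)%g) := valP _.
  by rewrite pxy qpy catA reduced_cat => /and3P[].
move/wmul_cat; rewrite -[wmul _ _]/(val (x^-1 * p * (p^-1 * q))%g).
by rewrite -mulgA mulVKg pxy qpy catA => ->.
Qed.

(** Geodesics issued from [a] are words, and those to [b] and [c] separate at
the end of their longest common prefix. *)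
Definition median a b c := (a * meet (a^-1 * b) (a^-1 * c))%g.

Lemma median_invariant h a b c :
  median (h * a)%g (h * b)%g (h * c)%g = (h * median a b c)%g.
Proof. by rewrite /median !invgM -!mulgA !mulKg. Qed.

Lemma medianP a b c : let m := median a b c in
  [/\ btw m a b, btw m a c & btw m b c].
Proof.
have [s [t []]] := lcpP (val (a^-1 * b)%g) (val (a^-1 * c)%g).
rewrite -val_meet => es et d.
have vb := val_divl es; have vc := val_divl et.
have am : (a^-1 * median a b c)%g = meet (a^-1 * b)%g (a^-1 * c)%g.
  by rewrite mulKg.
have mx x : ((median a b c)^-1 * x)%g =
    ((meet (a^-1 * b) (a^-1 * c))^-1 * (a^-1 * x))%g.
  by rewrite invgM -mulgA.
split; last by rewrite /btw !mx vb vc.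
  by apply/btwP; rewrite am mx vb.
by apply/btwP; rewrite am mx vc.
Qed.

(** This characterization carries the symmetry of the median, which its
definition from the first point hides, and identifies the medians of all faces
of a quadruple at once. *)
Lemma median_unique m a b c :
  btw m a b -> btw m a c -> btw m b c -> median a b c = m.
Proof.
move=> /btwP mab /btwP mac mbc.
rewrite /median (_ : meet _ _ = (a^-1 * m)%g) ?mulVKg //.
by apply: val_inj; rewrite val_meet mab mac lcp_cat.
Qed.

Lemma median_swap a b c : median a c b = median a b c.
Proof.
have [ab ac bc] := medianP a b c.
by apply: median_unique => //; rewrite btwC.
Qed.

Lemma median_rot a b c : median b c a = median a b c.
Proof.
have [ab ac bc] := medianP a b c.
by apply: median_unique; rewrite // btwC.
Qed.

(** The tree spanned by [x], [y], [z], [t] is a letter H whose bar is the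
segment from [p] to [q], with [x], [y] attached at [p] and [z], [t] at [q]. *)
Definition bridge p q x y z t : bool :=
  [&& btw p x y, btw q z t, btw p x z && btw p x t, btw p y z && btw p y t
    & btw q p z && btw q p t].

Lemma bridge_median p q x y z t : bridge p q x y z t ->
  [/\ median x y z = p, median x y t = p, median x z t = q
    & median y z t = q].
Proof.
case/and5P=> pxy qzt /andP[pxz pxt] /andP[pyz pyt] /andP[qpz qpt].
by split; apply: median_unique => //; apply: (@btw_trans p).
Qed.

(** From the median [p] of [a], [b], [c], these three points lie in different
directions, so [d] shares its direction with at most one of them; that point is
then paired with [d]. *)
Lemma four_points a b c d : exists p q,
  [\/ bridge p q a b c d, bridge p q a c b d | bridge p q b c a d].
Proof.
pose p := median a b c; exists p.
have bridgeI x y z : btw p x y -> btw p x z -> btw p y z -> btw p x d ->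
    btw p y d -> bridge p (median p z d) x y z d.
  move=> pxy pxz pyz pxd pyd; have [qpz qpd qzd] := medianP p z d.
  by rewrite /bridge pxy qzd pxz pxd pyz pyd qpz qpd.
have [pab pac pbc] := medianP a b c.
have [pba pca pcb] : [/\ btw p b a, btw p c a & btw p c b].
  by split; rewrite btwC.
have [pad|pad] := boolP (btw p a d); last first.
  exists (median p a d); apply: Or33.
  by apply: bridgeI => //; apply: diverge_same_head pad _.
have [pbd|pbd] := boolP (btw p b d).
  by exists (median p c d); apply: Or31; apply: bridgeI.
exists (median p b d); apply: Or32; apply: bridgeI => //.
exact: diverge_same_head pbd _.
Qed.

End Tree.

Local Open Scope ring_scope.

(** * Quasimorphisms that split along long overlaps *)

Section Cup.
Variables (R : realType) (n : nat).
Local Notation F := (free_group n).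
Implicit Types (a b c d p q x y z t : F) (f : F -> R).

(** Balls are finite because the rank is. *)
Lemma bounded_on_ball f L :
  exists K, forall g : F, (size (val g) <= L)%N -> `|f g| <= K.
Proof.
exists (\sum_(s : {bseq L of 'I_n * bool}) `|f (insubd (fg_one n) (val s))|).
move=> g gL.
rewrite (bigD1 (Bseq gL)) //= valKd lerDl.
by apply: sumr_ge0 => s _; apply: normr_ge0.
Qed.

(** Across a middle factor of length at least [L], the two outer factors do not
interact: [f] behaves like the count of patterns of length at most [L]. *)
Definition local L f := forall g h k : F,
  reduced (val g ++ val h ++ val k) -> (L <= size (val h))%N ->
  f (g * h * k)%g = f (g * h)%g + f (h * k)%g - f h.

(** The coboundary of [f] on [(x,z,t)] minus the one on [(y,z,t)], where the
terms in [z, t] have cancelled; for a bridge these two faces have the same median. *)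
Definition cross_difference f x y z t : R :=
  f (x^-1 * z)%g - f (x^-1 * t)%g - f (y^-1 * z)%g + f (y^-1 * t)%g.

Lemma local_btw L f p q x y :
  local L f -> btw p x y -> btw q p y -> (L <= size (val (p^-1 * q)%g))%N ->
  f (x^-1 * y)%g = f (x^-1 * q)%g + f (p^-1 * y)%g - f (p^-1 * q)%g.
Proof.
move=> fL /btwP pxy /btwP qpy Lpq.
have := fL (x^-1 * p)%g (p^-1 * q)%g (q^-1 * y)%g.
rewrite -!mulgA !mulVKg; apply=> //.
by rewrite -qpy -pxy; apply: valP.
Qed.

(** The dichotomy on the length of the bar: along a long one the cross
difference vanishes by locality, and along a short one the two values of [f] are close. *)
Lemma cross_bridge L f f' :
  quasimorphism f -> quasimorphism f' -> local L f' ->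
  exists C : R, forall a p q x y z t, bridge p q x y z t ->
    `|(f (a^-1 * p)%g - f (a^-1 * q)%g) * cross_difference f' x y z t| <= C.
Proof.
move=> [M fM] [M' fM'] fL; have [K fK] := bounded_on_ball f L.
exists ((M + K) * (M' + M')) => a p q x y z t.
case/and5P=> pxy qzt /andP[pxz pxt] /andP[pyz pyt] /andP[qpz qpt].
have C'0 : 0 <= M' + M'.
  by have := le_trans (normr_ge0 _) (fM' 1%g 1%g); lra.
have [Lpq|/ltnW Lpq] := leqP L (size (val (p^-1 * q)%g)).
  rewrite /cross_difference (local_btw fL pxz qpz) // (local_btw fL pxt qpt) //.
  rewrite (local_btw fL pyz qpz) // (local_btw fL pyt qpt) //.
  rewrite [X in _ * X](_ : _ = 0) ?mulr0 ?normr0; last by ring.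
  apply: mulr_ge0 => //; apply: addr_ge0.
    exact: le_trans (normr_ge0 _) (fM 1%g 1%g).
  by have := fK 1%g isT; apply: le_trans.
rewrite normrM; apply: ler_pM; rewrite ?normr_ge0 //.
  have := fK _ Lpq; have := fM (a^-1 * p)%g (p^-1 * q)%g.
  by rewrite -mulgA mulVKg !ler_norml; lra.
have := fM' (x^-1 * z)%g (z^-1 * t)%g; have := fM' (y^-1 * z)%g (z^-1 * t)%g.
by rewrite -!mulgA !mulVKg /cross_difference !ler_norml; lra.
Qed.

(** * A bounded primitive of the cup product *)

(** The value of [f] on the leg of the tripod from its first point to its
centre, times the coboundary of [f'], with the sign that makes its coboundary cancel the
unbounded part of the cup product in [cup_primitive]. *)
Definition leg_cochain f f' : cochain R F 2 := fun g =>
  let m := median (g ord0) (g (inord 1)) (g (inord 2)) in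
  - f ((g ord0)^-1 * m)%g * coboundary (homogenize f') g.

Lemma leg_cochainE f f' (g : nat -> F) : ncochain (leg_cochain f f') g =
  - f ((g 0%N)^-1 * median (g 0%N) (g 1%N) (g 2%N))%g *
  (f' ((g 1%N)^-1 * g 2%N)%g - f' ((g 0%N)^-1 * g 2%N)%g
   + f' ((g 0%N)^-1 * g 1%N)%g).
Proof.
rewrite /ncochain /leg_cochain !inordK //; congr (_ * _).
exact: coboundary_homogenizeE.
Qed.

(** Its coboundary is the cup product already for the first summand; the second
one makes it bounded. *)
Definition cup_primitive f f' : cochain R F 3 :=
  (cup_at (homogenize f) (coboundary (homogenize f')) : cochain R F 3) -
  coboundary (leg_cochain f f').

Lemma diag_invariant_homogenize f : diag_invariant (homogenize f).
Proof. by move=> h g; rewrite /homogenize invgM -mulgA mulKg. Qed.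

Lemma diag_invariant_coboundary k (c : cochain R F k) :
  diag_invariant c -> diag_invariant (coboundary c).
Proof.
move=> ci h g; rewrite /coboundary; apply: eq_bigr => i _; congr (_ * _).
exact: ci.
Qed.

Lemma diag_invariant_cup_primitive f f' : diag_invariant (cup_primitive f f').
Proof.
have bi := diag_invariant_coboundary (@diag_invariant_homogenize f').
have si : diag_invariant (leg_cochain f f').
  by move=> h g; rewrite /leg_cochain bi median_invariant invgM -mulgA mulKg.
move=> h g; rewrite [LHS]/(_ + - _) [RHS]/(_ + - _).
by rewrite (diag_invariant_coboundary si) /cup_at diag_invariant_homogenize bi.
Qed.

Lemma coboundary_cup_primitive f f' : coboundary (cup_primitive f f') =
  cup (coboundary (homogenize f)) (coboundary (homogenize f')).
Proof.
rewrite coboundaryB coboundaryK subr0; apply: ncochainP => g.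
rewrite cup_leibniz // coboundaryK [X in _ * X]cup_atE //.
by rewrite [ncochain 0 _](_ : _ = 0) // !mulr0 addr0.
Qed.

(** Replacing [f (a^-1 * b) + f (b^-1 * m)] by [f (a^-1 * m)], where [m] is the
median of the face without [a], costs a bounded error; the rest is the
alternating sum over the faces, which [four_points] turns into one of the
products bounded in [cross_bridge]. *)
Lemma bounded_cup_primitive L f f' : quasimorphism f -> quasimorphism f' ->
  (forall g, f' g^-1%g = - f' g) -> local L f' ->
  bounded_cochain (cup_primitive f f').
Proof.
move=> qf qf' f'N lf'; have [C fC] := cross_bridge qf qf' lf'.
case: (qf) (qf') => M fM [M' fM'].
exists (M * M' + C) => g0; rewrite ncochain_inord; set g := fun k => _.
have bM a b c : `|f' (b^-1 * c)%g - f' (a^-1 * c)%g + f' (a^-1 * b)%g| <= M'.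
  have := fM' (a^-1 * b)%g (b^-1 * c)%g.
  by rewrite -mulgA mulVKg [f' (a^-1 * b)%g + _]addrC addrAC.
rewrite [ncochain _ _](_ : _ =
  ncochain (cup_at (n := 3) (homogenize f) (coboundary (homogenize f'))) g
  - ncochain (coboundary (leg_cochain f f')) g) //.
rewrite cup_atE // coboundary_homogenizeE coboundaryE !big_ord_recl big_ord0.
rewrite !leg_cochainE /ncochain /homogenize /= /bump /=.
move: (g 0%N) (g 1%N) (g 2%N) (g 3%N) => a b c d {g g0}.
have f'C u v : f' (u^-1 * v)%g = - f' (v^-1 * u)%g.
  by rewrite -f'N invgM invgK.
set err := f (a^-1 * b)%g + f (b^-1 * median b c d)%g
  - f (a^-1 * median b c d)%g.
have errM : `|err| <= M.
  have := fM (a^-1 * b)%g (b^-1 * median b c d)%g.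
  by rewrite -mulgA mulVKg.
pose beta := f' (c^-1 * d)%g - f' (b^-1 * d)%g + f' (b^-1 * c)%g.
set total := (X in `|X|).
suff [s sC ->] : exists2 s : R, `|s| <= C & total = err * beta + s.
  apply: le_trans (ler_normD _ _) _; apply: lerD => //.
  by rewrite normrM ler_pM //; apply: bM.
(* In each case mi is the median of the face opposite to the i-th vertex. *)
have [p [q [br|br|br]]] := four_points a b c d.
- have [m3 m2 m1 m0] := bridge_median br.
  eexists; first exact: (fC a _ _ _ _ _ _ br).
  rewrite /total /err /beta /cross_difference m0 m1 m2 m3.
  by ring.
- have [m3 m1 m2 m0] := bridge_median br.
  (* Here the faces with median p carry the sign -1. *)
  exists (- ((f (a^-1 * p)%g - f (a^-1 * q)%g) * cross_difference f' a c b d)).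
    by rewrite normrN; apply: fC.
  rewrite median_swap in m3; rewrite -median_rot median_swap in m0.
  rewrite /total /err /beta /cross_difference m0 m1 m2 m3 (f'C c b).
  by ring.
have [m3 m0 m2 m1] := bridge_median br.
eexists; first exact: (fC a _ _ _ _ _ _ br).
rewrite median_rot in m3; rewrite -median_rot median_swap in m2.
rewrite -median_rot median_swap in m1.
rewrite /total /err /beta /cross_difference m0 m1 m2 m3 (f'C b a) (f'C c a).
by ring.
Qed.

Lemma cup_quasimorphism_local L f f'
    (qf : quasimorphism f) (qf' : quasimorphism f') :
  (forall g, f' g^-1%g = - f' g) -> local L f' ->
  Hb_cup (quasimorphism_class qf) (quasimorphism_class qf') = 0 :> Hb R F 4.
Proof.
move=> f'N lf'; rewrite Hb_cupE; apply/Hb_class_eq0.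
exists (cup_primitive f f'); last by rewrite coboundary_cup_primitive.
split; last exact: diag_invariant_cup_primitive.
exact: bounded_cup_primitive qf qf' f'N lf'.
Qed.

(** * Brooks quasimorphisms *)

(** An occurrence of [w] that starts in [s] ends before [u] begins, because [t]
is at least as long as [w]; it is therefore counted equally in
[s ++ t ++ u] and [s ++ t]. *)
Lemma occurrences_overlap (w s t u : seq ('I_n * bool)) :
  (size w <= size t)%N ->
  (occurrences w (s ++ t ++ u) + occurrences w t =
   occurrences w (s ++ t) + occurrences w (t ++ u))%N.
Proof.
move=> wt; elim: s => [|x s IH] /=; first by rewrite addnC.
rewrite !occurrences_cons -!addnA IH !addnA; congr (nat_of_bool _ + _ + _)%N.
rewrite !prefixE catA -cat_cons takel_cat //= size_cat; lia.
Qed.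

Lemma brooks_inv (w g : F) : brooks R w g^-1%g = - brooks R w g.
Proof. by rewrite /brooks; case: ifP => _; rewrite ?oppr0 // invgK opprB. Qed.

Lemma local_brooks (w : F) : local (size (val w)) (brooks R w).
Proof.
move=> g h k r wh; rewrite /brooks.
case: ifP => _; first by rewrite subr0 addr0.
have rgh : reduced (val g ++ val h).
  by move: r; rewrite catA reduced_cat => /and3P[].
have rhk : reduced (val h ++ val k) by move: r; rewrite reduced_cat => /and3P[].
have egh : val (g * h)%g = val g ++ val h by apply: wmul_cat.
have ehk : val (h * k)%g = val h ++ val k by apply: wmul_cat.
have eghk : val (g * h * k)%g = val g ++ val h ++ val k.
  by rewrite -mulgA -ehk; apply: wmul_cat; rewrite ehk.
have vV (x : F) : val x^-1%g = winv (val x) by [].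
have whV : (size (val w) <= size (winv (val h)))%N.
  by rewrite size_rev size_map.
rewrite !vV egh ehk eghk !winv_cat -!catA.
have := occurrences_overlap (val g) (val k) wh.
have := occurrences_overlap (winv (val k)) (winv (val g)) whV.
move/(congr1 (GRing.natmul (1 : R))); rewrite !natrD => e1.
move/(congr1 (GRing.natmul (1 : R))); rewrite !natrD => e2.
lra.
Qed.

End Cup.

Theorem theorem1 (R : realType) (n : nat) (n_gt1 : (1 < n)%N)
    (w w' : free_group n) :
  Hb_cup (brooks_class R w) (brooks_class R w') = 0%R :> Hb R (free_group n) 4.
Proof.
apply: cup_quasimorphism_local; last exact: local_brooks.
exact: brooks_inv.
Qed.
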